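(* Let $p$ be a prime and $A \subseteq \mathbb{F}_p$ with $|A| < \log_2\log_8\log_{32} p - 1$. Then $$|A+A|+|A\cdot A| \geq c\, |A|^{1+\frac{1}{3}-o(1)},$$ for some positive absolute constant $c$, where the $o(1)$ term tends to $0$ as $|A|\to\infty$ (independently of $p$).
   Context: $A+A=\{a+b: a,b\in A\}$ and $A\cdot A=\{ab : a,b\in A\}$. *)

(* Defs.v *)
From HB Require Import structures.
From mathcomp Require Import all_boot all_order all_algebra.
From mathcomp Require Import reals exp.

Set Implicit Arguments.
Unset Strict Implicit.
Unset Printing Implicit Defensive.

Import Order.TTheory GRing.Theory Num.Theory.
Local Open Scope ring_scope.

(* Since [ln x = 0] for [x <= 0], an iterated logarithm that is mathematically
   undefined at its last step evaluates to 0. *)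
Definition log (R : realType) (b x : R) : R := ln x / ln b.

Definition sumset (p : nat) (A : {set 'F_p}) : {set 'F_p} :=
  [set a + b | a in A, b in A].

Definition prodset (p : nat) (A : {set 'F_p}) : {set 'F_p} :=
  [set a * b | a in A, b in A].

(* Main.v *)
Require Import Defs.
From HB Require Import structures.
From mathcomp Require Import all_boot all_order all_algebra.
From mathcomp Require Import perm complex zify ring lra.

(** Rectification. Treat the elements [a_1, ..., a_n] of [A] one after the other
    and look for complex numbers [z_1, ..., z_n] such that every integer
    polynomial of small complexity vanishes at [a] iff it vanishes at [z]. To find
    [z_n] given the others, consider the gcd over the complex numbers of all small
    relations satisfied by [a_n]: if each of its roots killed a small polynomial
    not killed by [a_n], a product of such polynomials would be a linear
    combination of the relations; this is a statement on ranks of matrices, hence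
    on minors, which are small polynomials in one variable less, and it transfers
    back to the finite field, a contradiction. Each step raises the complexity to
    the fifth power, so that one third of [A] can be embedded.

    Sum-product over the complex numbers (Solymosi, Solymosi-Wong). Restrict to
    a sector. If [L] is the set of slopes of lines through the origin with at
    least [t] points of [A x A], add the points of each line to those of the line
    with the nearest slope in [L]. A sum determines a point of the plane lying in
    the disc around a slope through its nearest neighbour, and a point lies in
    boundedly many such discs, so [#|L| t^2 <= 8 #|A + A|^2]. Summing over [t]
    bounds the multiplicative energy by [16 #|A + A|^2 (1 + ln #|A|)], and
    Cauchy-Schwarz gives [#|A|^4 <= #|A A| E]. *)

Set Implicit Arguments.
Unset Strict Implicit.
Unset Printing Implicit Defensive.

Import Order.TTheory GRing.Theory Num.Theory.
Local Open Scope ring_scope.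

(** * Sums of few monomials *)

Section Sums.
Context {V : nmodType}.
Implicit Types (S T : seq V) (x y : V).

(** The added 0 allows fewer than [N] terms. The result is a finite list, so that it can be filtered
    and multiplied out. *)
Definition sums S (N : nat) : seq V :=
  iter N (fun L => [seq x + y | x <- L, y <- 0 :: S]) [:: 0].

Lemma sumsP S N x :
  reflect (exists s, [/\ (size s <= N)%N, {subset s <= S} & x = \sum_(y <- s) y])
          (x \in sums S N).
Proof.
apply: (iffP idP).
  elim: N x => [|N IH] x.
    by rewrite inE => /eqP ->; exists [::]; rewrite big_nil.
  rewrite /sums iterS; case/allpairsP => -[u v] /= [/IH [s [ss sS ->]] vS ->].
  rewrite inE in vS; case/orP: vS => [/eqP ->|vS].
    by exists s; rewrite addr0 (leqW ss).
  exists (v :: s); split=> //; last by rewrite big_cons addrC.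
  by move=> w; rewrite inE => /orP[/eqP ->|/sS].
case=> s [ss sS ->]; elim: N s ss sS => [|N IH] [|v s] // ss sS.
- by rewrite big_nil inE.
- rewrite /sums iterS; apply/allpairsP; exists (0, 0); split;
    rewrite ?big_nil ?addr0 ?mem_head //=.
  by have := IH [::] isT; rewrite big_nil; apply.
- rewrite big_cons addrC /sums iterS; apply/allpairsP.
  exists (\sum_(y <- s) y, v) => /=.
  split=> //; first by apply: IH => // w ws; apply: sS; rewrite inE ws orbT.
  by rewrite inE sS ?mem_head ?orbT.
Qed.

Lemma sums_sub S T N N' : (N <= N')%N -> {subset S <= T} ->
  {subset sums S N <= sums T N'}.
Proof.
move=> NN ST x /sumsP[s [ss sS ->]]; apply/sumsP; exists s; split=> //.
  exact: leq_trans NN.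
by move=> y /sS/ST.
Qed.

Lemma mem_sums S x : x \in S -> x \in sums S 1.
Proof.
move=> xS; apply/sumsP; exists [:: x]; split=> //; last by rewrite big_seq1.
by move=> y; rewrite inE => /eqP ->.
Qed.

Lemma sums0 S N : 0 \in sums S N.
Proof. by apply/sumsP; exists [::]; rewrite big_nil. Qed.

Lemma sumsD S N N' x y :
  x \in sums S N -> y \in sums S N' -> x + y \in sums S (N + N').
Proof.
move=> /sumsP[s [ss sS ->]] /sumsP[t [ts tS ->]]; apply/sumsP; exists (s ++ t).
split; rewrite ?size_cat ?leq_add ?big_cat //.
by move=> w; rewrite mem_cat => /orP[/sS|/tS].
Qed.

Lemma sums_sum (I : Type) (r : seq I) (F : I -> V) S N :
  (forall i, F i \in sums S N) ->
  \sum_(i <- r) F i \in sums S (size r * N).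
Proof.
move=> FS; elim: r => [|i r IH]; first by rewrite big_nil sums0.
by rewrite big_cons mulSn sumsD.
Qed.

End Sums.
Arguments sums : simpl never.

Lemma sums_map (V W : nmodType) (f : {additive V -> W}) (S : seq V) N (y : W) :
  y \in sums (map f S) N -> exists2 x, x \in sums S N & y = f x.
Proof.
case/sumsP=> s [ss sS ->]; elim: N s ss sS => [|N IH] [|v s] //= ss sS.
- by exists 0; rewrite ?sums0 ?big_nil ?raddf0.
- by exists 0; rewrite ?sums0 ?big_nil ?raddf0.
- have [w ws|x xS ex] := IH s ss; first by apply: sS; rewrite inE ws orbT.
  have /mapP[u uS ->] : v \in map f S by apply: sS; rewrite mem_head.
  exists (u + x); first by rewrite -add1n; apply: sumsD => //; apply: mem_sums.
  by rewrite big_cons ex raddfD.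
Qed.

Lemma map_sums (V W : nmodType) (f : {additive V -> W}) (S : seq V) (T : seq W)
    N (x : V) : {in S, forall y, (f y \in T) || (f y == 0)} ->
  x \in sums S N -> f x \in sums T N.
Proof.
move=> fST /sumsP[s [ss sS ->]]; rewrite raddf_sum.
apply: (sums_sub ss (fun _ => id)); elim: s {ss} sS => [|v s IH] sS.
  by rewrite big_nil sums0.
rewrite big_cons /= -add1n sumsD //; last first.
  by apply: IH => w ws; apply: sS; rewrite inE ws orbT.
have /fST/orP[|/eqP ->] := sS v (mem_head _ _); first exact: mem_sums.
exact: sums0.
Qed.

(** [M k] models the signed monomials of complexity at most [k]: 1 at every level makes the levels
    increase, -1 at level 0 makes them stable under negation. In [sums (M k) N], [N] then bounds the
    total size of the integer coefficients. *)
Definition monomials (R : comNzRingType) (M : nat -> seq R) :=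
  [/\ forall k, 1 \in M k, -1 \in M 0%N
    & forall k l x y, x \in M k -> y \in M l -> x * y \in M (k + l)%N].

Section Monomials.
Context {R : comNzRingType} {M : nat -> seq R}.
Hypothesis monM : monomials M.

Lemma monomials_sub k l : (k <= l)%N -> {subset M k <= M l}.
Proof.
case: monM => M1 _ Mm kl x xM.
by rewrite -(subnKC kl) -[x]mulr1; apply: Mm.
Qed.

Lemma monomialsN k x : x \in M k -> - x \in M k.
Proof. by case: monM => _ MN Mm xM; rewrite -mulN1r -[k]add0n Mm. Qed.

Lemma sumsN k N x : x \in sums (M k) N -> - x \in sums (M k) N.
Proof.
apply: (@map_sums _ _ (GRing.opp : {additive R -> R})) => y yM.
by rewrite /= monomialsN.
Qed.

Lemma sumsM k l N N' x y : x \in sums (M k) N -> y \in sums (M l) N' ->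
  x * y \in sums (M (k + l)) (N * N').
Proof.
case: monM => _ _ Mm /sumsP[s [ss sS ->]] /sumsP[t [ts tS ->]].
apply/sumsP; exists [seq u * v | u <- s, v <- t]; split.
- by rewrite size_allpairs leq_mul.
- by move=> w /allpairsP[[u v] /= [us vt ->]]; apply: Mm; [apply: sS | apply: tS].
- rewrite big_allpairs_dep big_distrl /=.
  by apply: eq_bigr => u _; rewrite big_distrr.
Qed.

Lemma sums_prod (I : Type) (r : seq I) (F : I -> R) k N :
  (forall i, F i \in sums (M k) N) ->
  \prod_(i <- r) F i \in sums (M (size r * k)) (N ^ size r).
Proof.
move=> FS; elim: r => [|i r IH].
  by rewrite big_nil expn0; apply: mem_sums; case: monM.
by rewrite big_cons mulSn expnS sumsM.
Qed.

(** Leibniz expansion: [r!] signed products of [r] entries each. *)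
Lemma sums_det r (B : 'M[R]_r) k N :
  (forall i j, B i j \in sums (M k) N) ->
  \det B \in sums (M (r * k)) (r`! * N ^ r).
Proof.
move=> BS; rewrite /determinant /index_enum -enumT.
have -> : (r`! = size (enum 'S_r))%N by rewrite -cardE card_Sn.
apply: sums_sum => s.
have PS : \prod_i B i (s i) \in sums (M (r * k)) (N ^ r).
  have := sums_prod (index_enum 'I_r) (fun i => BS i (s i)).
  by rewrite /index_enum -enumT size_enum_ord.
by case: (odd_perm s); rewrite ?expr1 ?mulN1r ?expr0 ?mul1r ?sumsN.
Qed.

(** The same [k] bounds the exponent of the new variable and the complexity of the coefficients. *)
Definition poly_monomials k : seq {poly R} :=
  [seq x *: 'X^i | x <- M k, i <- iota 0 k.+1].

Lemma poly_monomialsP : monomials poly_monomials.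
Proof.
case: monM => M1 MN Mm; split.
- move=> k; apply/allpairsP; exists (1, 0%N).
  by split; rewrite ?mem_iota ?expr0 ?scale1r //=.
- by apply/allpairsP; exists (-1, 0%N); split; rewrite ?mem_iota ?expr0 ?scaleN1r.
- move=> k l _ _ /allpairsP[[x i] [xM ik ->]] /allpairsP[[y j] [yM jl ->]].
  apply/allpairsP; exists (x * y, (i + j)%N); split.
  + exact: Mm.
  + by move: ik jl; rewrite !mem_iota /=; lia.
  + by rewrite /= -scalerAl -scalerAr scalerA -exprD.
Qed.

Lemma coef_sums k N g i : g \in sums (poly_monomials k) N ->
  g`_i \in sums (M k) N.
Proof.
apply: (@map_sums _ _ (coefp i : {additive {poly R} -> R})).
move=> _ /allpairsP[[x j] /= [xM _ ->]]; rewrite /coefp.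
rewrite coefZ coefXn; case: eqP => _; rewrite ?mulr1 ?xM //.
by rewrite mulr0 eqxx orbT.
Qed.

Lemma size_sums k N g : g \in sums (poly_monomials k) N -> (size g <= k.+1)%N.
Proof.
case/sumsP=> s [_ sS ->]; rewrite big_seq.
apply: (big_ind (fun g : {poly R} => size g <= k.+1)%N).
- by rewrite size_poly0.
- by move=> u v us vs; apply: leq_trans (size_polyD _ _) _; rewrite geq_max us vs.
- move=> u /sS/allpairsP[[x j] [_ jk ->]].
  apply: leq_trans (size_scale_leq _ _) _; rewrite size_polyXn.
  by move: jk; rewrite mem_iota.
Qed.

Definition adjoin_monomials (t : R) k : seq R :=
  [seq g.[t] | g <- poly_monomials k].

Lemma adjoin_monomialsP t : monomials (adjoin_monomials t).
Proof.
case: poly_monomialsP => M1 MN Mm; split.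
- by move=> k; apply/mapP; exists 1 => //; rewrite hornerC.
- by apply/mapP; exists (-1) => //; rewrite hornerN hornerC.
- move=> k l _ _ /mapP[f fM ->] /mapP[g gM ->].
  by apply/mapP; exists (f * g); rewrite ?hornerM ?Mm.
Qed.

Lemma adjoin_monomials_sub t k : {subset M k <= adjoin_monomials t k}.
Proof.
move=> x xM; apply/mapP; exists x%:P; last by rewrite hornerC.
by apply/allpairsP; exists (x, 0%N); split; rewrite ?mem_iota ?expr0 ?alg_polyC.
Qed.

Lemma mem_adjoin_monomials t : t \in adjoin_monomials t 1.
Proof.
apply/mapP; exists 'X; last by rewrite hornerX.
by apply/allpairsP; exists (1, 1%N); split; rewrite ?scale1r ?expr1 //; case: monM.
Qed.

Lemma sums_adjoin t k N x : x \in sums (adjoin_monomials t k) N ->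
  exists2 g, g \in sums (poly_monomials k) N & x = g.[t].
Proof. exact: (@sums_map _ _ (horner_eval t : {additive {poly R} -> R})). Qed.

End Monomials.

(** * Linear algebra and Bezout relations *)

(** Together with [minor_leq_rank], this lets ranks over two fields be compared through vanishing of
    minors. *)
Lemma exists_maximal_minor (F : fieldType) m n (B : 'M[F]_(m, n)) :
  exists (f : 'I_(\rank B) -> 'I_m) (g : 'I_(\rank B) -> 'I_n),
    \det (mxsub f g B) != 0.
Proof.
pose f := maxrankfun B; pose C := rowsub f B.
have rC : row_full C^T by rewrite /row_full mxrank_tr; exact: maxrowsub_free.
exists f, (fullrankfun rC).
have := fullrowsub_unit rC; rewrite unitmxE unitfE -det_tr.
by rewrite trmx_mxsub trmxK /C -mxsub_comp.
Qed.

Lemma minor_leq_rank (F : fieldType) m n r (B : 'M[F]_(m, n))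
    (f : 'I_r -> 'I_m) (g : 'I_r -> 'I_n) :
  \det (mxsub f g B) != 0 -> (r <= \rank B)%N.
Proof.
move=> dn0; apply: leq_trans (mxrankS (rowsub_sub f B)).
rewrite -mxrank_tr; apply: leq_trans (mxrankS (rowsub_sub g _)).
rewrite mxrank_unit // unitmxE unitfE -det_tr !trmx_mxsub trmxK.
by rewrite -mxsub_comp.
Qed.

Lemma Bezoutp_family (F : fieldType) m (g : 'I_m -> {poly F}) :
  exists u : 'I_m -> {poly F}, forall i, \sum_j u j * g j %| g i.
Proof.
elim: m g => [|m IH] g; first by exists (fun=> 0) => -[].
have [u ug] := IH (fun i => g (lift ord0 i)).
set d := \sum_j _ in ug.
have [[v w] /= evw] := Bezoutp (g ord0) d.
exists (fun i => if unlift ord0 i is Some j then w * u j else v) => i.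
rewrite big_ord_recl unlift_none.
under eq_bigr do rewrite liftK -mulrA.
rewrite -big_distrr /= -/d (eqp_dvdl _ evw).
case: (unliftP ord0 i) => [j ->|->]; last exact: dvdp_gcdl.
exact: dvdp_trans (dvdp_gcdr _ _) (ug j).
Qed.

(** All cofactors except that of [g i0] are reduced modulo [g i0], the quotients going into the
    cofactor [w] of [g i0]. Then [w * g i0] is [h] minus polynomials of small size, which bounds
    [w]. *)
Lemma Bezoutp_family_size (F : fieldType) m (g : 'I_m -> {poly F})
    (i0 : 'I_m) (h : {poly F}) k d :
  g i0 != 0 -> (forall i, size (g i) <= k.+1)%N ->
  (size h <= d)%N -> (k + k <= d)%N ->
  (forall q, (forall i, q %| g i) -> q %| h) ->
  exists2 u : 'I_m -> {poly F}, h = \sum_i u i * g i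
    & forall i, (size (u i) <= d)%N.
Proof.
move=> g0 sg sh kd gh.
have [u ug] := Bezoutp_family g.
have /dvdpP[q hq] := gh _ ug.
pose v i : {poly F} := (q * u i) %% g i0.
pose w : {poly F} := \sum_(i | i != i0) (q * u i) %/ g i0 * g i + q * u i0.
have ew : h = w * g i0 + \sum_(i | i != i0) v i * g i.
  rewrite {1}hq big_distrr /= (bigD1 i0) //= mulrDl big_distrl /=.
  rewrite mulrA [RHS]addrAC -big_split /= addrC; congr (_ + _).
  apply: eq_bigr => i _; rewrite mulrA {1}(divp_eq (q * u i) (g i0)) /v.
  by rewrite mulrDl mulrAC.
have sv i : (size (v i) <= k)%N.
  by rewrite -ltnS; apply: leq_trans (sg i0); rewrite ltn_modp.
exists (fun i => if i == i0 then w else v i).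
  rewrite (bigD1 i0) //= eqxx ew; congr (_ + _).
  by apply: eq_bigr => i /negPf ->.
move=> i; case: eqP => _; last by apply: leq_trans (sv i) _; lia.
have [->|w0] := eqVneq w 0; first by rewrite size_poly0.
have sw : (size (w * g i0)%R <= d)%N.
  have -> : w * g i0 = h - \sum_(i | i != i0) v i * g i by rewrite ew addrK.
  apply: leq_trans (size_polyD _ _) _; rewrite geq_max sh size_polyN.
  apply: leq_trans (size_sum _ _ _) _; apply/bigmax_leqP => j _.
  apply: leq_trans (size_polyMleq _ _) _.
  by apply: leq_trans kd; rewrite -subn1 leq_subLR add1n -addnS leq_add.
apply: leq_trans sw; rewrite size_mul // -subn1 -addnBA ?leq_addr //.
by rewrite size_poly_gt0.
Qed.

(** * Adjoining one element *)

Lemma mul_poly_rV (F : comNzRingType) n (p : {poly F}) a : (size p <= n)%N ->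
  poly_rV p *m (\col_(c < n) a ^+ c) = p.[a]%:M.
Proof.
move=> sp; apply/matrixP=> i j; rewrite !ord1 !mxE eqxx mulr1n.
by rewrite (horner_coef_wide _ sp); apply: eq_bigr => c _; rewrite !mxE.
Qed.

(** Each occurrence of a repeated root brings its own factor [h z]. *)
Lemma dvdp_prod_root (F : fieldType) (rs : seq F) (h : F -> {poly F}) :
  {in rs, forall z, root (h z) z} ->
  \prod_(z <- rs) ('X - z%:P) %| \prod_(z <- rs) h z.
Proof.
elim: rs => [|z rs IH] rh; first by rewrite !big_nil.
rewrite !big_cons dvdp_mul ?dvdp_XsubCl ?rh ?mem_head //.
by apply: IH => w ws; apply: rh; rewrite inE ws orbT.
Qed.

Section Extension.
Context {S : comNzRingType} {F K : fieldType}.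
Context (f1 : {rmorphism S -> F}) (f2 : {rmorphism S -> K}).
Local Notation p1 := (map_poly f1).
Local Notation p2 := (map_poly f2).

(** One element of [S] carries both values to be compared; [S] will be the product ring of [F] and
    [K] with its projections. *)
Definition same_zero (x : S) := (f1 x == 0) = (f2 x == 0).

Lemma mxrank_same_zero m n (B : 'M[S]_(m, n)) :
  (forall r (f : 'I_r -> 'I_m) (g : 'I_r -> 'I_n), (r <= n)%N ->
     same_zero (\det (mxsub f g B))) ->
  \rank (map_mx f1 B) = \rank (map_mx f2 B).
Proof.
move=> dB; apply/eqP; rewrite eqn_leq; apply/andP; split.
- have [f [g]] := exists_maximal_minor (map_mx f1 B).
  rewrite -map_mxsub det_map_mx dB ?rank_leq_col // => dn0.
  by apply: (@minor_leq_rank _ _ _ _ _ f g); rewrite -map_mxsub det_map_mx.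
- have [f [g]] := exists_maximal_minor (map_mx f2 B).
  rewrite -map_mxsub det_map_mx -dB ?rank_leq_col // => dn0.
  by apply: (@minor_leq_rank _ _ _ _ _ f g); rewrite -map_mxsub det_map_mx.
Qed.

(* A dependency [h = sum u_i g_i] that holds over [K] is
   witnessed by equalities of ranks, hence by vanishing of minors, and is
   therefore inherited by [F]. *)
Lemma same_zero_dependency (G : seq {poly S}) (h : {poly S}) (a : F) d n
    (u : 'I_(size G) -> {poly K}) :
  (size h <= n)%N ->
  (forall g, g \in G -> (size g + d <= n.+1)%N) ->
  (forall i, size (u i) <= d)%N -> p2 h = \sum_i u i * p2 G`_i ->
  (forall r (B : 'M[S]_r), (r <= n)%N ->
     (forall i j, exists2 g, g \in 0 :: h :: G & exists l, B i j = g`_l) ->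
     same_zero (\det B)) ->
  (forall g, g \in G -> (p1 g).[a] = 0) -> (p1 h).[a] = 0.
Proof.
move=> sh sG su eh sz Ga.
(* As in a Sylvester matrix, the rows of [B] are shifts of the relations; they span the combinations
   with cofactors of size at most [d]. *)
pose Q := [seq 'X^j * g | g <- G, j <- iota 0 d].
pose B : 'M[S]_(size Q, n) := \matrix_(i < size Q) poly_rV Q`_i.
pose B' := col_mx (poly_rV h) B.
have szQ q : q \in Q -> (size q <= n)%N.
  case/allpairsP=> -[g j] [gG jd ->] /=; move: jd; rewrite mem_iota /= => jd.
  rewrite (leq_trans (size_polyMleq _ _)) // size_polyXn.
  by rewrite -subn1 leq_subLR add1n (leq_trans _ (sG g gG)) // addnC leq_add2l.
have rkE (C : 'M[S]_(1 + size Q, n)) : (forall i j, exists2 g, g \in 0 :: h :: G &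
    exists l, C i j = g`_l) -> \rank (map_mx f1 C) = \rank (map_mx f2 C).
  move=> CE; apply: mxrank_same_zero => r f g rn; apply: sz => // i j.
  by rewrite mxE; apply: CE.
have Qcoef (q : {poly S}) l : q \in Q ->
    exists2 g, g \in 0 :: h :: G & exists l', q`_l = g`_l'.
  case/allpairsP=> -[g j] [gG jd ->] /=; rewrite coefXnM; case: ifP => _.
    by exists 0; rewrite ?mem_head //; exists 0%N; rewrite coef0.
  by exists g; [rewrite !inE gG !orbT | exists (l - j)%N].
have hmem : h \in [:: 0, h & G] by rewrite !inE eqxx orbT.
have rB' : \rank (map_mx f1 B') = \rank (map_mx f2 B').
  apply: rkE => i j; rewrite -(splitK i); case: (split i) => c /=.
    by rewrite col_mxEu mxE; exists h => //; exists j.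
  by rewrite col_mxEd !mxE; apply: Qcoef; rewrite mem_nth.
have rB : \rank (map_mx f1 B) = \rank (map_mx f2 B).
  apply: mxrank_same_zero => r f g rn; apply: sz => // i j.
  by rewrite !mxE; apply: Qcoef; rewrite mem_nth.
have hB2 : (poly_rV (p2 h) <= map_mx f2 B)%MS.
  rewrite eh raddf_sum summx_sub // => i _.
  have -> : u i * p2 G`_i = \sum_(j < d) (u i)`_j *: ('X^j * p2 G`_i).
    have -> : \sum_(j < d) (u i)`_j *: ('X^j * p2 G`_i) =
              (\poly_(j < d) (u i)`_j) * p2 G`_i.
      by rewrite poly_def big_distrl; apply: eq_bigr => j _; rewrite scalerAl.
    congr (_ * _); apply/polyP => j; rewrite coef_poly; case: ltnP => // dj.
    by rewrite nth_default // (leq_trans (su i)).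
  rewrite raddf_sum summx_sub // => j _; rewrite /= linearZ scalemx_sub //.
  have qQ : 'X^j * G`_i \in Q.
    by apply/allpairsP; exists (G`_i, (j : nat)); rewrite mem_nth //= mem_iota /=.
  have ltq : (index ('X^j * G`_i)%R Q < size Q)%N by rewrite index_mem.
  apply: (eq_row_sub (Ordinal ltq)); rewrite -map_row rowK /= nth_index //.
  by rewrite map_poly_rV rmorphM /= map_polyXn.
(* Over [K], appending the row [h] does not raise the rank; the equalities [rB] and [rB'] carry this
   to [F]. *)
have rr2 : \rank (map_mx f2 B') = \rank (map_mx f2 B).
  by rewrite map_col_mx map_poly_rV -addsmxE; have /addsmx_idPr -> := hB2.
have hB1 : (poly_rV (p1 h) <= map_mx f1 B)%MS.
  have sub : (map_mx f1 B <= map_mx f1 B')%MS.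
    by rewrite map_col_mx -addsmxE addsmxSr.
  have [_] := mxrank_leqif_sup sub; rewrite rB rB' rr2 eqxx => /esym.
  rewrite map_col_mx map_poly_rV => /(submx_trans _); apply.
  by rewrite -addsmxE addsmxSl.
have /submxP[D hD] := hB1.
(* Multiplying by the powers of [a] evaluates each row at [a], where all relations vanish. *)
have Bv : map_mx f1 B *m (\col_(c < n) a ^+ c) = 0.
  apply/row_matrixP => i; rewrite row_mul row0 -map_row rowK map_poly_rV.
  have iQ : Q`_i \in Q by rewrite mem_nth.
  rewrite mul_poly_rV; last by rewrite (leq_trans (size_poly _ _)) ?szQ.
  case/allpairsP: iQ => -[g j] [gG _ ->] /=.
  by rewrite rmorphM /= hornerM (Ga g) // mulr0 raddf0.
have : poly_rV (p1 h) *m (\col_(c < n) a ^+ c) = 0 by rewrite hD -mulmxA Bv mulmx0.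
rewrite mul_poly_rV ?(leq_trans (size_poly _ _)) // => /matrixP/(_ 0 0).
by rewrite !mxE eqxx.
Qed.
End Extension.

Section Adjoin.
Context {S : comNzRingType} {F : fieldType} {K : closedFieldType}.
Context (f1 : {rmorphism S -> F}) (f2 : {rmorphism S -> K}).
Hypothesis f12_surj : forall a z, exists2 t, f1 t = a & f2 t = z.
Local Notation p1 := (map_poly f1).
Local Notation p2 := (map_poly f2).

(* If every root [z] of the gcd of the second components of the relations
   satisfied by [a] violates the claim, then it does so through some [h z] that
   does not vanish at [a]. The product of these [h z] is a combination of the
   relations on the [K] side, hence on the [F] side, so it vanishes at [a]. *)
Lemma same_zero_adjoin (M : nat -> seq S) (N k : nat) (a : F) (n := (k.+1 ^ 2)%N) :
  monomials M -> (0 < N)%N -> (0 < k)%N ->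
  {in sums (M (n * (k * k))%N) (n`! * (N ^ k) ^ n), forall x, same_zero f1 f2 x} ->
  exists2 t : S, f1 t = a &
    {in sums (adjoin_monomials (M := M) t k) N, forall x, same_zero f1 f2 x}.
Proof.
move=> monM N0 k0 szM.
have n0 : (0 < n)%N by rewrite /n expn_gt0.
pose P := sums (poly_monomials (M := M) k) N.
suff [z zP] : exists z, forall g, g \in P ->
    ((p1 g).[a] == 0) = ((p2 g).[z] == 0).
  have [t ta tz] := f12_surj a z; exists t => // x.
  case/(sums_adjoin (M := M)) => g gP ->; rewrite /same_zero -!horner_map ta tz.
  exact: zP.
have kk : (k <= k * k)%N by rewrite leq_pmull.
have Nk : (N <= N ^ k)%N by rewrite -{1}[N]expn1 leq_pexp2l.
have sumsP2 k' N' : (k' <= k * k)%N -> (N' <= N ^ k)%N ->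
    {subset sums (M k') N' <= sums (M (k * k)%N) (N ^ k)}.
  by move=> hk hN; apply: sums_sub => //; apply: monomials_sub.
(* The coefficients of [g] are themselves small, so [szM] applies to each of them. *)
have p2_0 g : g \in P -> p2 g = 0 -> p1 g = 0.
  move=> gP g0; apply/polyP=> i; rewrite coef_map coef0; apply/eqP.
  suff -> : same_zero f1 f2 g`_i by rewrite -coef_map g0 coef0.
  apply: szM; have := coef_sums i gP; apply: sums_sub.
    apply: leq_trans Nk _; rewrite -[X in (X <= _)%N]mul1n leq_mul ?fact_gt0 //.
    by rewrite -{1}[(N ^ k)%N]expn1 leq_pexp2l // expn_gt0 N0.
  by apply: monomials_sub => //; apply: leq_trans kk _; rewrite leq_pmull.
pose G := [seq g <- P | (p1 g).[a] == 0].
have GP g : g \in G = ((p1 g).[a] == 0) && (g \in P) by rewrite mem_filter.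
have [/hasP[g0 g0G g0n0]|G0] := boolP (has (fun g => p2 g != 0) G); last first.
  (* When all relations vanish over [K], [z] only has to avoid the roots of finitely many nonzero
     polynomials. *)
  pose q := \prod_(g <- P | (p1 g).[a] != 0) p2 g.
  have q0 : q != 0.
    rewrite prodf_seq_neq0; apply/allP => g gP; apply/implyP; apply: contra.
    by move=> /eqP/(p2_0 _ gP) ->; rewrite horner0.
  have /closed_nonrootP[z qz] := q0; exists z => g gP.
  have [ga|ga] := boolP (_ == 0).
    have /hasPn/(_ g) := G0; rewrite GP ga gP negbK => /(_ isT)/eqP ->.
    by rewrite horner0 eqxx.
  apply/esym/negbTE; move: qz; rewrite /root horner_prod prodf_seq_neq0.
  by move=> /allP/(_ g gP); rewrite ga.
(* The candidates for [z] are the roots of the gcd [d], at most [k] with multiplicity. *)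
have [u ug] := Bezoutp_family (fun i : 'I_(size G) => p2 G`_i).
set d := \sum_j _ in ug.
have dG g : g \in G -> d %| p2 g.
  move=> gG; have lt : (index g G < size G)%N by rewrite index_mem.
  by have := ug (Ordinal lt); rewrite /= nth_index.
have sP g : g \in P -> (size g <= k.+1)%N by exact: size_sums.
have d0 : d != 0 by apply: contraNneq g0n0 => e; have := dG _ g0G; rewrite e dvd0p.
have [rs ed] := closed_field_poly_normal d.
have srs : (size rs <= k)%N.
  have -> : size rs = (size d).-1.
    by rewrite ed size_scale ?lead_coef_eq0 // size_prod_XsubC.
  have /sP sg0 : g0 \in P by move: g0G; rewrite GP => /andP[].
  rewrite -ltnS prednK ?size_poly_gt0 //.
  by rewrite (leq_trans (dvdp_leq g0n0 (dG _ g0G)))// (leq_trans (size_poly _ _)).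
have [/hasP[z zrs zP]|bad] :=
    boolP (has (fun z => all (fun h => (p2 h).[z] != 0)
                             [seq h <- P | (p1 h).[a] != 0]) rs).
  exists z => g gP; have [ga|ga] := boolP (_ == 0).
    have /dG : g \in G by rewrite GP ga gP.
    move=> /dvdpP[q ->]; rewrite hornerM ed hornerZ.
    suff /eqP -> : (\prod_(z <- rs) ('X - z%:P)).[z] == 0 by rewrite !mulr0 eqxx.
    by rewrite -/(root _ _) root_prod_XsubC.
  by apply/esym/negbTE; have /allP := zP; apply; rewrite mem_filter ga.
(* The default 1 does not vanish at [a] either, so [hP] holds for every [z]. *)
pose h z := head 1 [seq h <- P | ((p1 h).[a] != 0) && ((p2 h).[z] == 0)].
have hP z : (h z \in P) && ((p1 (h z)).[a] != 0).
  rewrite /h; case E : [seq _ <- _ | _] => [|g s] /=.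
    rewrite rmorph1 hornerC oner_eq0 andbT.
    have := mem_sums (let: And3 m1 _ _ := poly_monomialsP monM in m1 k).
    exact: sums_sub.
  have : g \in g :: s by rewrite mem_head.
  by rewrite -E mem_filter => /andP[/andP[-> _] ->].
have hroot : {in rs, forall z, root (p2 (h z)) z}.
  move=> z zrs; have /hasPn/(_ z zrs)/allPn[g] := bad.
  rewrite mem_filter negbK => /andP[ga gP] gz; rewrite /h.
  case E : [seq _ <- _ | _] => [|g' s] /=.
    by have : g \in [::] by rewrite -E mem_filter ga gz gP.
  have : g' \in g' :: s by rewrite mem_head.
  by rewrite -E mem_filter => /andP[/andP[_]].
pose H := \prod_(z <- rs) h z.
(* At most [k] factors: this is the source of [k * k] and [N ^ k]. *)
have HS : H \in sums (poly_monomials (M := M) (k * k)%N) (N ^ k).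
  have := sums_prod (poly_monomialsP monM) rs (fun z => proj1 (andP (hP z))).
  apply: sums_sub; first by rewrite leq_pexp2l.
  by apply: (monomials_sub (poly_monomialsP monM)); rewrite leq_mul2r srs orbT.
have sH : (size H <= (k * k).+1)%N := size_sums HS.
have Ha : (p1 H).[a] != 0.
  rewrite rmorph_prod horner_prod prodf_seq_neq0; apply/allP => z _ /=.
  by have /andP[] := hP z.
have lt0 : (index g0 G < size G)%N by rewrite index_mem.
have := @Bezoutp_family_size _ _ (fun i : 'I_(size G) => p2 G`_i)
  (Ordinal lt0) (p2 H) k (k * k).+1.
case=> [||||q qG|v Hv sv].
- by rewrite /= nth_index.
- move=> i; apply: leq_trans (size_poly _ _) (sP _ _).
  by have := mem_nth 0 (ltn_ord i); rewrite GP => /andP[].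
- exact: leq_trans (size_poly _ _) sH.
- by nia.
- have qd : q %| d.
    apply: (big_ind (fun x => q %| x)); rewrite ?dvdp0 //.
      by move=> x y; apply: dvdp_add.
    by move=> i _; apply: dvdp_mull.
  apply: dvdp_trans qd _; rewrite ed dvdpZl ?lead_coef_eq0 //.
  by rewrite rmorph_prod; apply: dvdp_prod_root.
case/eqP: Ha; apply: (@same_zero_dependency S F K f1 f2 G H a (k * k).+1 n v) => //.
(* The [(k + 1)^2] columns have room for [H] and for the shifts [X^j * g] with [j <= k * k], of size
   at most [k * k + k + 1]. *)
- by apply: leq_trans sH _; rewrite /n; nia.
- move=> g; rewrite GP => /andP[_ /sP sg].
  by apply: (@leq_trans (k.+1 + (k * k).+1)); rewrite ?leq_add2r // /n; nia.
- move=> r B rn BE; apply: szM.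
  have BS i j : B i j \in sums (M (k * k)%N) (N ^ k).
    have [g gG [l ->]] := BE i j; move: gG; rewrite !inE.
    case/or3P=> [/eqP ->|/eqP ->|]; first by rewrite coef0 sums0.
      exact: coef_sums.
    by rewrite GP => /andP[_ /(coef_sums l)]; apply: sumsP2.
  have := sums_det monM BS; apply: sums_sub.
    by rewrite leq_mul ?leq_fact // leq_pexp2l // expn_gt0 N0.
  by apply: monomials_sub => //; rewrite leq_mul2r rn orbT.
- by move=> g; rewrite GP => /andP[/eqP].
Qed.

End Adjoin.

(** * Rectification *)

(** With no variables the sums are bounded integers; each element of [L] then enters with exponent
    at most [k]. *)
Fixpoint monomials_in (S : comNzRingType) (L : seq S) : nat -> seq S :=
  if L is t :: L' then adjoin_monomials (M := monomials_in L') t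
  else fun=> [:: 1; -1].

Lemma monomials_inP (S : comNzRingType) (L : seq S) : monomials (monomials_in L).
Proof.
elim: L => [|t L IH] /=; last exact: adjoin_monomialsP.
split=> [k||k l x y]; rewrite ?inE ?eqxx ?orbT //.
by case/orP=> /eqP -> /orP[] /eqP ->; rewrite ?mulrNN ?mulr1 ?mul1r eqxx ?orbT.
Qed.

Lemma mem_monomials_in (S : comNzRingType) (L : seq S) t :
  t \in L -> t \in monomials_in L 1.
Proof.
elim: L => //= u L IH; rewrite inE => /orP[/eqP ->|/IH tL].
  exact/mem_adjoin_monomials/monomials_inP.
exact: adjoin_monomials_sub.
Qed.

(** Allowing [2 ^ k] terms at complexity [k] leaves a single parameter. As [n! <= 2 ^ (n * n)], all
    reduces to [n * n + k * k * n <= k ^ 5], which fails at [k = 4] (1025 against 1024). *)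
Lemma complexity_step k (n := (k.+1 ^ 2)%N) : (5 <= k)%N ->
  (n * (k * k) <= k ^ 5)%N /\ (n`! * ((2 ^ k) ^ k) ^ n <= 2 ^ (k ^ 5))%N.
Proof.
move=> k5; have k4 : (k.+1 ^ 2 * k.+1 ^ 2 + k * k * k.+1 ^ 2 <= k ^ 5)%N.
  have -> : (k ^ 5 = k * k * k * k * k)%N by rewrite !expnS expn0 muln1 !mulnA.
  have -> : (k.+1 ^ 2 = k * k + 2 * k + 1)%N by rewrite !expnS expn0 muln1; lia.
  by nia.
split; first by rewrite /n; lia.
apply: (@leq_trans (2 ^ (n * n) * 2 ^ (k * k * n))).
  have -> : (((2 ^ k) ^ k) ^ n = 2 ^ (k * k * n))%N by rewrite -!expnM mulnA.
  rewrite leq_mul2r; apply/orP; right; rewrite expnM.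
  apply: (@leq_trans (n ^ n)); last by rewrite leq_exp2r // ltnW // ltn_expl.
  have : (n <= n)%N by []; elim: {1 3 5}n => // m IH mn.
  by rewrite factS expnS leq_mul // IH // ltnW.
by rewrite -expnD leq_pexp2l.
Qed.

(** A Freiman isomorphism of order 2 for addition and multiplication at once. *)
Definition sum_product_iso (F : finFieldType) (K : fieldType)
    (A : {set F}) (phi : F -> K) :=
  forall a b c d, a \in A -> b \in A -> c \in A -> d \in A ->
    ((a + b == c + d) = (phi a + phi b == phi c + phi d)) /\
    ((a * b == c * d) = (phi a * phi b == phi c * phi d)).

Section Rectification.
Context {K : numClosedFieldType} {p : nat}.
Hypothesis p_pr : prime p.
Local Notation F := 'F_p.
Let S : comNzRingType := (F * K)%type.
Let f1 : {rmorphism S -> F} := fst.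
Let f2 : {rmorphism S -> K} := snd.

(** Such a sum is an integer of absolute value below [p], so it vanishes modulo [p] only if it is 0,
    as in characteristic 0. *)
Lemma same_zero_int N : (N < p)%N ->
  {in sums [:: 1; -1 : S] N, forall x, same_zero f1 f2 x}.
Proof.
move=> Np x /sumsP[s [ss sS ->]].
have [m mN ->] : exists2 m : int, (absz m <= N)%N & \sum_(y <- s) y = m%:~R :> S.
  elim: s N ss sS {Np} => [|y s IH] N ss sS; first by exists 0; rewrite ?big_nil.
  case: N ss => // N ss.
  have [w ws|m mN em] := IH N ss; first by apply: sS; rewrite inE ws orbT.
  have := sS y (mem_head _ _); rewrite big_cons em !inE => /orP[] /eqP ->.
    by exists (1 + m); rewrite ?rmorphD //; lia.
  by exists (-1 + m); rewrite ?rmorphD //; lia.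
rewrite /same_zero !rmorph_int !intr_eq0.
have -> : (m%:~R == 0 :> F) = ((absz m)%:R == 0 :> F).
  by case: m {mN} => n //; rewrite NegzE mulrNz oppr_eq0 abszN.
rewrite -(dvdn_pcharf (pchar_Fp p_pr)) -absz_eq0.
case: (posnP (absz m)) => [->|m0]; first by rewrite dvdn0.
by rewrite gtnNdvd ?(leq_ltn_trans mN) // eqn0Ngt m0.
Qed.

(** The tail is lifted first, with [k ^ 5] in place of [k], so that adjoining the head ends at
    [k]. *)
Lemma same_zero_lift (l : seq F) k : (5 <= k)%N ->
  (2 ^ k ^ 5 ^ size l < p)%N ->
  exists2 L : seq S, map f1 L = l &
    {in sums (monomials_in L k) (2 ^ k), forall x, same_zero f1 f2 x}.
Proof.
elim: l k => [|a l IH] k k5 /=.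
  by rewrite expn0 expn1 => kp; exists [::] => //; apply: same_zero_int.
rewrite expnS expnM => kp.
have k0 : (0 < k)%N by exact: leq_trans k5.
have k5' : (5 <= k ^ 5)%N.
  by rewrite (leq_trans k5) // -{1}[k]expn1 leq_pexp2l.
have [L Ll LP] := IH _ k5' kp.
have [h1 h2] := complexity_step k5.
have [a' z|||||t ta tP] :=
    @same_zero_adjoin S F K f1 f2 _ (monomials_in L) (2 ^ k) k a.
- by exists (a', z).
- exact: monomials_inP.
- by rewrite expn_gt0.
- exact: k0.
- move=> x xS; apply: LP; apply: sums_sub xS => //.
  exact/monomials_sub/h1/monomials_inP.
by exists (t :: L); rewrite /= ?ta ?Ll.
Qed.

Lemma rectification (A : {set F}) : (2 ^ 8 ^ 5 ^ #|A| < p)%N ->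
  exists phi : F -> K, sum_product_iso A phi.
Proof.
(* The relations [a + b - c - d] and [a * b - c * d] have complexity at most 2 and at most 4 terms;
   8 matches the base of the second logarithm. *)
rewrite cardE => /(same_zero_lift (isT : 5 <= 8)%N)[L LA LP].
pose phi a := (nth (0 : S) L (index a (enum A))).2.
exists phi => a b c d.
have memL x : x \in A -> ((x, phi x) : S) \in L.
  rewrite -mem_enum => xA.
  have xL : (index x (enum A) < size L)%N.
    by rewrite -(size_map f1) LA index_mem.
  suff -> : (x, phi x) = nth (0 : S) L (index x (enum A)) by rewrite mem_nth.
  rewrite [RHS]surjective_pairing; congr pair.
  rewrite -[LHS](nth_index 0 xA); move: (index _ _) xL => i iL.
  by rewrite -LA (nth_map (0 : S)).
move=> /memL aL /memL bL /memL cL /memL dL.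
have monL := monomials_inP L.
have sumsE k N x : (k <= 8)%N -> (N <= 2 ^ 8)%N -> x \in sums (monomials_in L k) N ->
    (x.1 == 0) = (x.2 == 0).
  move=> k8 N8 xS; apply: LP; apply: sums_sub xS => //.
  exact: monomials_sub.
have inL x : x \in L -> x \in sums (monomials_in L 1) 1.
  by move=> /mem_monomials_in/mem_sums.
split; [rewrite -(subr_eq0 (a + b)) -(subr_eq0 (phi a + phi b))
       | rewrite -(subr_eq0 (a * b)) -(subr_eq0 (phi a * phi b))].
  apply: (sumsE 1%N 4%N ((a, phi a) + (b, phi b) - ((c, phi c) + (d, phi d)))) => //.
  by apply: (sumsD (N := 2) (N' := 2)); rewrite ?sumsN //;
    apply: (sumsD (N := 1) (N' := 1)); apply: inL.
apply: (sumsE 2%N 2%N ((a, phi a) * (b, phi b) - ((c, phi c) * (d, phi d)))) => //.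
by apply: (sumsD (N := 1) (N' := 1)); rewrite ?sumsN //;
  apply: (sumsM monL (N := 1) (N' := 1) (k := 1) (l := 1)); apply: inL.
Qed.

End Rectification.

(** * Sum-product in the plane *)

Section Plane.
Local Notation Re := complex.Re.
Local Notation Im := complex.Im.
Context {R : rcfType}.
Implicit Types u v : R[i].

Definition sqn u : R := Re u ^+ 2 + Im u ^+ 2.
Definition dot u v : R := Re u * Re v + Im u * Im v.

Lemma sqnM u v : sqn (u * v) = sqn u * sqn v.
Proof. by case: u v => [a b] [c d]; rewrite /sqn /=; ring. Qed.

Lemma sqnBC u v : sqn (u - v) = sqn (v - u).
Proof. by case: u v => [a b] [c d]; rewrite /sqn /=; ring. Qed.

Lemma sqn_gt0 u : u != 0 -> 0 < sqn u.
Proof.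
case: u => [a b] u0; rewrite lt0r /sqn /= addr_ge0 ?sqr_ge0 // andbT.
rewrite paddr_eq0 ?sqr_ge0 // !sqrf_eq0; apply: contra u0.
by case/andP=> /eqP -> /eqP ->.
Qed.

Lemma sqnD u v : sqn (u + v) = sqn u + dot u v *+ 2 + sqn v.
Proof. by case: u v => [a b] [c d]; rewrite /sqn /dot /=; ring. Qed.

Lemma sqnB u v : sqn (u - v) = sqn u - dot u v *+ 2 + sqn v.
Proof. by case: u v => [a b] [c d]; rewrite /sqn /dot /=; ring. Qed.

Lemma sqn_ge0 u : 0 <= sqn u.
Proof. by rewrite addr_ge0 ?sqr_ge0. Qed.

Lemma dot_gt0_neq0 u : 0 < dot u u -> u != 0.
Proof. by apply: contraTneq => ->; rewrite /dot /= !mul0r addr0 ltxx. Qed.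

(** Two signs and the comparison of absolute values cut the plane into eight sectors of 45
    degrees. *)
Definition octant u : bool * bool * bool :=
  (0 <= Re u, 0 <= Im u, Im u ^+ 2 <= Re u ^+ 2).

(** The hypotheses give [x1 * x2 < x1 ^+ 2] and [x1 * x2 < x2 ^+ 2]; multiplying them is absurd. *)
Lemma wide_angle_false (x1 y1 x2 y2 : R) :
  0 <= x1 * x2 -> 0 <= y1 * y2 -> y1 ^+ 2 <= x1 ^+ 2 -> y2 ^+ 2 <= x2 ^+ 2 ->
  (x1 * x2 + y1 * y2) *+ 2 < x1 ^+ 2 + y1 ^+ 2 ->
  (x1 * x2 + y1 * y2) *+ 2 < x2 ^+ 2 + y2 ^+ 2 -> False.
Proof.
move=> hx hy h1 h2 g1 g2.
have a1 : x1 * x2 < x1 ^+ 2 by lra.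
have a2 : x1 * x2 < x2 ^+ 2 by lra.
have := ltr_pM hx hx a1 a2.
by rewrite -exprMn expr2 ltxx.
Qed.

Lemma same_sign_mul_ge0 (x y : R) : (0 <= x) = (0 <= y) -> 0 <= x * y.
Proof.
case: (leP 0 x) => hx /esym; first by move=> hy; rewrite mulr_ge0.
by move/negbT; rewrite -ltNge => hy; rewrite mulr_le0 // ltW.
Qed.

(* Two points of a common octant are seen from the origin under an angle smaller
   than 60 degrees, so their distance is not the largest side of the triangle. *)
Lemma octant_separation u v : octant u = octant v ->
  sqn u < sqn (u - v) -> sqn v < sqn (u - v) -> False.
Proof.
rewrite sqnB => -[/same_sign_mul_ge0 hx /same_sign_mul_ge0 hy e] h1 h2.
have g1 : dot u v *+ 2 < sqn v by lra.
have g2 : dot u v *+ 2 < sqn u by lra.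
move: e g1 g2; rewrite /dot /sqn.
have [l1 /esym l2 g1 g2|l1 /esym/negbT l2 g1 g2] := leP (Im u ^+ 2) (Re u ^+ 2).
  exact: (wide_angle_false hx hy l1 l2 g2 g1).
rewrite -ltNge in l2.
by apply: (wide_angle_false hy hx (ltW l1) (ltW l2)); lra.
Qed.

End Plane.

Lemma card_dep_setX (T1 T2 : finType) (P : {set T1}) (Q : T1 -> {set T2}) :
  #|[set x : T1 * T2 | (x.1 \in P) && (x.2 \in Q x.1)]|
  = (\sum_(i in P) #|Q i|)%N.
Proof.
under [RHS]eq_bigr do rewrite -sum1_card.
by rewrite pair_big_dep -sum1dep_card.
Qed.

(** Cauchy-Schwarz, by summing [2 * q x * q y <= q x ^ 2 + q y ^ 2] over all pairs. *)
Lemma sum_sqr_leq (T : finType) (P : {set T}) (q : T -> nat) :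
  ((\sum_(x in P) q x) ^ 2 <= #|P| * \sum_(x in P) q x ^ 2)%N.
Proof.
rewrite -(leq_pmul2l (isT : 0 < 2)%N) -mulnn big_distrlr /= big_distrr /=.
have -> : (2 * (#|P| * \sum_(x in P) q x ^ 2) =
    \sum_(x in P) \sum_(y in P) (q x ^ 2 + q y ^ 2))%N.
  under [RHS]eq_bigr do rewrite big_split sum_nat_const /=.
  by rewrite big_split sum_nat_const -big_distrr /= mul2n addnn.
apply: leq_sum => x _; rewrite big_distrr /=; apply: leq_sum => y _.
exact: nat_Cauchy.
Qed.

(** * Rich lines and multiplicative energy *)

Section SumProduct.
Context {R : rcfType} {F : finFieldType} (A : {set F}) (phi : F -> R[i]).
Hypothesis phi_iso : sum_product_iso A phi.
Hypothesis A0 : 0 \notin A.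
Hypothesis phi_dot : {in A &, forall a b, 0 < dot (phi a) (phi b)}.
Local Notation AA := [set a + b | a in A, b in A].
Local Notation AM := [set a * b | a in A, b in A].

(** Here [a] stands for the point [(a, l * a)] of [A x A]. *)
Definition ray (l : F) : {set F} := [set a in A | l * a \in A].

Definition slope (l : F) : R[i] :=
  if [pick a in ray l] is Some a then phi (l * a) / phi a else 0.

Lemma A_neq0 a : a \in A -> a != 0.
Proof. by apply: contraTneq => ->. Qed.

Lemma phi_neq0 a : a \in A -> phi a != 0.
Proof. by move=> aA; apply/dot_gt0_neq0/phi_dot. Qed.

(** The image slope does not depend on the point picked: [phi] preserves the equality of products
    [(l * a) * b = (l * b) * a]. *)
Lemma slopeE l a : a \in ray l -> phi (l * a) = slope l * phi a.
Proof.
rewrite /slope; case: pickP => [b|/(_ a) -> //].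
rewrite !inE => /andP[bA lbA] /andP[aA laA].
have [_] := phi_iso laA bA lbA aA.
rewrite mulrAC eqxx => /esym/eqP e.
by rewrite mulrAC -e mulfK ?phi_neq0.
Qed.

Lemma slope_inj l m a b : a \in ray l -> b \in ray m ->
  slope l = slope m -> l = m.
Proof.
move=> al bm e; have el := slopeE al; have em := slopeE bm.
move: al bm; rewrite !inE => /andP[aA laA] /andP[bA mbA].
have [_] := phi_iso laA bA mbA aA.
rewrite el em e [X in _ = (X == _)]mulrAC eqxx => /eqP h.
apply: (mulIf (A_neq0 aA)); apply: (mulIf (A_neq0 bA)).
by rewrite h mulrAC.
Qed.

Definition rich (t : nat) : {set F} := [set l | t <= #|ray l|]%N.

Lemma leq_card_sumset : (#|A| <= #|AA|)%N.
Proof.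
have [->|[a aA]] := set_0Vmem A; first by rewrite cards0.
rewrite -(card_imset _ (addrI a)); apply: subset_leq_card.
by apply/subsetP => _ /imsetP[b bA ->]; apply/imset2P; exists a b.
Qed.

(* The quotient of the coordinates of a sum of points on the lines of slopes
   [slope l] and [slope m] lies in the disc around [slope l] through [slope m]. *)
Lemma sum_slope_close l m a b : l != m -> a \in ray l -> b \in ray m ->
  sqn (slope l - (phi (l * a) + phi (m * b)) / (phi a + phi b))
    < sqn (slope l - slope m).
Proof.
move=> lm al bm; rewrite (slopeE al) (slopeE bm).
have slm : 0 < sqn (slope l - slope m).
  apply: sqn_gt0; rewrite subr_eq0; apply: contra lm => /eqP e.
  exact/eqP/(slope_inj al bm e).
move: al bm; rewrite !inE => /andP[aA _] /andP[bA _].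
(* The angle between the two vectors is acute. *)
have lt : sqn (phi b) < sqn (phi a + phi b).
  have := phi_dot aA bA; have := sqn_gt0 (phi_neq0 aA); rewrite sqnD; lra.
have X0 : phi a + phi b != 0.
  by apply: contraTneq lt => ->; rewrite -leNgt /sqn /= expr0n addr0 sqn_ge0.
have -> : slope l - (slope l * phi a + slope m * phi b) / (phi a + phi b) =
    (slope l - slope m) * (phi b / (phi a + phi b)) by field.
rewrite sqnM gtr_pMr // -(ltr_pM2r (sqn_gt0 X0)) mul1r -sqnM divfK //.
Qed.

(** The implication stands under the existential so that a neighbour function defined on all of [F]
    can be extracted. *)
Lemma rich_neighbour t (l : F) : (1 < #|rich t|)%N ->
  exists m, l \in rich t -> [/\ m \in rich t, m != l &
    forall k, k \in rich t -> k != l ->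
      sqn (slope l - slope m) <= sqn (slope l - slope k)].
Proof.
move=> gt1.
have [m0 /andP[m0t m0l]] : exists m, (m \in rich t) && (m != l).
  apply/existsP; rewrite -negb_forall_in; apply: contraL gt1 => /forall_inP e.
  rewrite -leqNgt; rewrite -(cards1 l); apply: subset_leq_card.
  by apply/subsetP => m mt; rewrite inE e.
exists [arg min_(m < m0 | (m \in rich t) && (m != l))
          sqn (slope l - slope m)]%O => _.
case: arg_minP => [|m /andP[mt ml] min]; first by rewrite m0t.
by split=> // k kt kl; apply: min; rewrite kt.
Qed.

(** Triples of a rich line, a point on it and a point on the nearest rich line are mapped
    injectively to the sum of the points, in [AA x AA], and one of eight octants. *)
Lemma card_rich t : (0 < t)%N ->
  (#|rich t| * t ^ 2 <= 8 * #|AA| ^ 2)%N.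
Proof.
move=> t0; have [le1|gt1] := leqP #|rich t| 1.
  have [->|[l lt]] := set_0Vmem (rich t); first by rewrite cards0.
  apply: leq_mul => //; first exact: leq_trans le1 _.
  rewrite leq_exp2r // (leq_trans _ leq_card_sumset) //.
  move: lt; rewrite inE => /leq_trans; apply; apply: subset_leq_card.
  by apply/subsetP => a; rewrite inE => /andP[].
have /fin_all_exists[nn nnP] := fun l => rich_neighbour l gt1.
pose D := [set x : F * (F * F) | (x.1 \in rich t) &&
             (x.2 \in setX (ray x.1) (ray (nn x.1)))].
have cD : (#|rich t| * t ^ 2 <= #|D|)%N.
  rewrite (card_dep_setX _ (fun l => setX (ray l) (ray (nn l)))) -sum_nat_const.
  apply: leq_sum => l lt.
  rewrite cardsX -mulnn leq_mul //; first by move: lt; rewrite inE.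
  by have [+ _ _] := nnP l lt; rewrite inE.
apply: leq_trans cD _.
pose w x := (phi (x.1 * x.2.1) + phi (nn x.1 * x.2.2)) / (phi x.2.1 + phi x.2.2).
pose f (x : F * (F * F)) := ((x.2.1 + x.2.2, x.1 * x.2.1 + nn x.1 * x.2.2),
                             octant (slope x.1 - w x)).
have DP x : x \in D -> [/\ x.1 \in rich t, x.2.1 \in ray x.1
    & x.2.2 \in ray (nn x.1)].
  by case: x => l [a b]; rewrite in_set in_setX => /andP[? /andP[]].
have finj : {in D &, injective f}.
  move=> [l [a b]] [l' [a' b']] /DP[/= lt al bl] /DP[/= lt' al' bl'] E.
  have e1 : a + b = a' + b' by have := congr1 (fun z => z.1.1) E.
  have e2 : l * a + nn l * b = l' * a' + nn l' * b'.
    by have := congr1 (fun z => z.1.2) E.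
  have [mt ml min] := nnP l lt; have [mt' ml' min'] := nnP l' lt'.
  (* On the same line, the two sums determine [a] and [b] because [nn l] differs from [l]. *)
  have [ll|ll] := eqVneq l l'.
    subst l'; have : (l - nn l) * a = (l - nn l) * a'.
      have eb : b = a' + b' - a by rewrite -e1 addrC addKr.
      apply/eqP; rewrite -subr_eq0; move/eqP: e2; rewrite eb -subr_eq0 => /eqP <-.
      by apply/eqP; ring.
    move/(mulfI _) => h; have ea : a = a' by apply: h; rewrite subr_eq0 eq_sym.
    by subst a'; move/addrI: e1 => ->.
  have ew : w (l, (a, b)) = w (l', (a', b')).
    move: al bl al' bl'; rewrite !in_set => /andP[aA laA] /andP[bA lbA].
    move=> /andP[aA' laA'] /andP[bA' lbA'].
    rewrite /w /=; congr (_ / _); apply/eqP.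
      by have [<- _] := phi_iso laA lbA laA' lbA'; apply/eqP.
    by have [<- _] := phi_iso aA bA aA' bA'; apply/eqP.
  have c1 : sqn (slope l - w (l, (a, b))) < sqn (slope l - slope (nn l)).
    by apply: sum_slope_close; rewrite // eq_sym.
  have c2 : sqn (slope l' - w (l', (a', b'))) < sqn (slope l' - slope (nn l')).
    by apply: sum_slope_close; rewrite // eq_sym.
  have dE : slope l - slope l' =
      slope l - w (l, (a, b)) - (slope l' - w (l', (a', b'))).
    by rewrite ew opprB addrA subrK.
  (* The common point [w] is seen from both slopes in the same octant, and is closer to each than
     that slope's nearest neighbour, hence than the other slope. *)
  have [] := @octant_separation _ (slope l - w (l, (a, b)))
                                  (slope l' - w (l', (a', b'))).
  - by have := congr1 (fun z => z.2) E.
  - by rewrite -dE; apply: lt_le_trans c1 (min _ lt' _); rewrite eq_sym.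
  - by rewrite -dE sqnBC; apply: lt_le_trans c2 (min' _ lt _).
rewrite -(card_in_imset finj).
apply: (@leq_trans #|setX (setX (AA) (AA)) [set: bool * bool * bool]|).
  apply: subset_leq_card; apply/subsetP => _ /imsetP[[l [a b]] /DP/= [_ al bl] ->].
  move: al bl; rewrite !in_set => /andP[aA laA] /andP[bA lbA].
  by rewrite andbT; apply/andP; split; apply: imset2_f.
by rewrite !cardsX cardsT !card_prod card_bool mulnC mulnn.
Qed.

(** Cauchy-Schwarz for the number [q x] of representations of [x] as a product; the squares count
    solutions of [a * b = c * d], sorted by the ratio [a / c]. *)
Lemma energy_leq : (#|A| ^ 4 <= #|AM| * \sum_(l : F) #|ray l| ^ 2)%N.
Proof.
pose q x := #|[set y in setX A A | y.1 * y.2 == x]|.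
have -> : (#|A| ^ 4 = (\sum_(x in AM) q x) ^ 2)%N.
  have -> : (\sum_(x in AM) q x)%N = #|setX A A|.
    rewrite -sum1_card (partition_big (fun y => y.1 * y.2) (mem (AM))) /=.
      apply: eq_bigr => x _; rewrite /q -sum1_card; apply: eq_bigl => y.
      by rewrite inE.
    by move=> y; rewrite inE => /andP[y1 y2]; apply: imset2_f.
  by rewrite cardsX mulnn -expnM.
apply: leq_trans (sum_sqr_leq _ _) _; rewrite leq_mul2l; apply/orP; right.
under eq_bigr do rewrite -mulnn -cardsX.
rewrite -card_dep_setX.
under [leqRHS]eq_bigr do rewrite -mulnn -cardsX.
rewrite [leqRHS](eq_bigl (fun l => l \in [set: F])); last by move=> l; rewrite inE.
rewrite -[leqRHS]card_dep_setX.
(* Both [c] and [b] lie in the ray of [a / c], which sends them to [a] and [d]. *)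
pose f (x : F * ((F * F) * (F * F))) := (x.2.1.1 / x.2.2.1, (x.2.2.1, x.2.1.2)).
set D := [set x | _].
have DP x : x \in D -> [/\ x.1 = x.2.1.1 * x.2.1.2, x.1 = x.2.2.1 * x.2.2.2,
    x.2.1.1 \in A, x.2.1.2 \in A & (x.2.2.1 \in A) && (x.2.2.2 \in A)].
  by rewrite !inE => /andP[_ /andP[/andP[/andP[-> ->] /eqP ->] /andP[-> /eqP ->]]].
have finj : {in D &, injective f}.
  move=> [x [[a b] [c d]]] [x' [[a' b'] [c' d']]].
  move=> /DP/= [xE xE' aA bA /andP[cA dA]] /DP/= [xF xF' aA' bA' /andP[cA' dA']].
  rewrite /f /= => -[e1 e2 e3]; subst c' b'.
  have ea : a = a' by apply: (mulIf (invr_neq0 (A_neq0 cA))).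
  subst a'; have ed : d = d' by apply: (mulfI (A_neq0 cA)); rewrite -xE' -xF' xE xF.
  by subst d'; rewrite xE xF.
rewrite -(card_in_imset finj); apply: subset_leq_card; apply/subsetP => y.
case/imsetP => -[x [[a b] [c d]]] /DP/= [xE xE' aA bA /andP[cA dA]] ->.
rewrite !inE /= cA bA divfK ?A_neq0 // aA /=.
by rewrite mulrAC -xE xE' mulrAC mulfV ?A_neq0 // mul1r.
Qed.

Lemma sum_product_rectified :
  (#|A| ^ 4)%:R <= 16%:R * (#|AM| * #|AA| ^ 2)%:R
                  * \sum_(t < #|A|) (t.+1%:R : R)^-1.
Proof.
(* Summation by layers: [r ^ 2] is at most the sum of [2 * t.+1] over [t < r]. *)
have le1 : (\sum_(l : F) #|ray l| ^ 2 <=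
            \sum_(t < #|A|) 2 * t.+1 * #|rich t.+1|)%N.
  have -> : (\sum_(t < #|A|) 2 * t.+1 * #|rich t.+1| =
      \sum_(l : F) \sum_(t < #|A| | t < #|ray l|) 2 * t.+1)%N.
    rewrite (exchange_big_dep xpredT) //=; apply: eq_bigr => t _.
    by rewrite sum_nat_cond_const mulnC.
  apply: leq_sum => l _.
  have rA : (#|ray l| <= #|A|)%N.
    by apply: subset_leq_card; apply/subsetP => a; rewrite inE => /andP[].
  rewrite -(big_ord_widen _ (fun t => 2 * t.+1)%N rA).
  elim: #|ray l| => // r IH; rewrite big_ord_recr /=.
  by apply: leq_trans (leq_add IH (leqnn _)); rewrite -!mulnn; lia.
apply: (@le_trans _ _ (#|AM| * \sum_(t < #|A|) 2 * t.+1 * #|rich t.+1|)%:R).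
  by rewrite ler_nat; apply: leq_trans energy_leq _; rewrite leq_mul2l le1 orbT.
have -> : 16%:R * (#|AM| * #|AA| ^ 2)%:R * \sum_(t < #|A|) (t.+1%:R : R)^-1
    = #|AM|%:R * \sum_(t < #|A|) (16 * #|AA| ^ 2)%:R / t.+1%:R.
  by rewrite -mulr_sumr !natrM; ring.
rewrite natrM ler_wpM2l ?ler0n // natr_sum; apply: ler_sum => t _.
rewrite ler_pdivlMr ?ltr0n // -natrM ler_nat.
have := card_rich (ltn0Sn t); rewrite -mulnn; lia.
Qed.

End SumProduct.

(** Both coordinate products are nonnegative, and the dominant coordinate is nonzero in both
    vectors. *)
Lemma octant_dot_gt0 (R : rcfType) (u v : R[i]) :
  octant u = octant v -> u != 0 -> v != 0 -> 0 < dot u v.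
Proof.
move=> -[/same_sign_mul_ge0 hx /same_sign_mul_ge0 hy e].
move=> /sqn_gt0; rewrite {1}/sqn => u0 /sqn_gt0; rewrite {1}/sqn => v0.
have [l1|l1] := boolP (complex.Im u ^+ 2 <= complex.Re u ^+ 2);
  move: e; rewrite ?l1 ?(negPf l1) => /esym.
  move=> l2; rewrite ltr_wpDr // lt0r hx andbT mulf_neq0 //.
    by apply: contraTneq u0 => h; move: l1; rewrite h; nra.
  by apply: contraTneq v0 => h; move: l2; rewrite h; nra.
move/negbT; rewrite -ltNge => l2; rewrite -ltNge in l1.
rewrite ltr_wpDl // lt0r hy andbT mulf_neq0 //.
  by apply: contraTneq l1 => h; rewrite h expr0n -leNgt sqr_ge0.
by apply: contraTneq l2 => h; rewrite h expr0n -leNgt sqr_ge0.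
Qed.

(** * Passage to a sector and to a third of the set *)

Lemma sum_product_iso_sub (F : finFieldType) (K : fieldType) (A B : {set F})
    (phi : F -> K) :
  B \subset A -> sum_product_iso A phi -> sum_product_iso B phi.
Proof.
move=> /subsetP BA iso a b c d aB bB cB dB.
exact: iso (BA _ aB) (BA _ bB) (BA _ cB) (BA _ dB).
Qed.

Lemma sum_product_iso_inj (F : finFieldType) (K : fieldType) (A : {set F})
    (phi : F -> K) : sum_product_iso A phi -> {in A &, injective phi}.
Proof.
move=> iso a b aA bA e; apply: (addIr a); apply/eqP.
by have [-> _] := iso a a b a aA aA bA aA; rewrite e.
Qed.

(** Discard 0 and the element mapped to 0, at most two in all since [phi] is injective, and keep the
    most populated octant. *)
Lemma sum_product_dense_sector (R : rcfType) (F : finFieldType) (A : {set F})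
    (phi : F -> R[i]) : sum_product_iso A phi ->
  exists B : {set F}, [/\ B \subset A, (#|A| <= 8 * #|B| + 2)%N, 0 \notin B &
    {in B &, forall a b, 0 < dot (phi a) (phi b)}].
Proof.
move=> iso.
pose Z := [set a in A | (a == 0) || (phi a == 0)].
pose sector q := [set a in A :\: Z | octant (phi a) == q].
pose q0 := [arg max_(q > (true, true, true)) #|sector q|].
have q0P q : (#|sector q| <= #|sector q0|)%N.
  by rewrite /q0; case: arg_maxnP => // i _; apply.
have cZ : (#|Z| <= 2)%N.
  have ZS : Z \subset [set a in A | a == 0] :|: [set a in A | phi a == 0].
    by apply/subsetP => a; rewrite !inE -andb_orr.
  apply: leq_trans (subset_leq_card ZS) _.
  apply: leq_trans (leq_card_setU _ _) _; apply: (@leq_add _ _ 1 1).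
    by apply/card_le1_eqP => a b; rewrite !inE => /andP[_ /eqP ->] /andP[_ /eqP ->].
  apply/card_le1_eqP => a b; rewrite !inE => /andP[aA /eqP a0] /andP[bA /eqP b0].
  by apply: (sum_product_iso_inj iso) => //; rewrite a0 b0.
exists (sector q0); split.
- by apply/subsetP => a; rewrite !inE => /andP[/andP[_]].
- have -> : #|A| = (#|A :\: Z| + #|Z|)%N.
    rewrite -(cardsID Z A) addnC; congr (_ + _)%N; apply: eq_card => a.
    by rewrite !inE; case: (a \in A).
  apply: leq_add => //.
  rewrite -sum1_card (partition_big (fun a => octant (phi a)) xpredT) //=.
  have -> : (8 * #|sector q0| = \sum_(q : bool * bool * bool) #|sector q0|)%N.
    by rewrite sum_nat_const !card_prod card_bool.
  apply: leq_sum => q _; apply: leq_trans (q0P q).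
  by rewrite -sum1_card; apply: eq_leq; apply: eq_bigl => a; rewrite !inE.
- by rewrite !inE eqxx /= andbT; case: (0 \in A).
- move=> a b; rewrite !inE => /andP[/andP[aZ aA] /eqP ea] /andP[/andP[bZ bA] /eqP eb].
  apply: octant_dot_gt0; first by rewrite ea eb.
    by apply: contra aZ => ->; rewrite aA orbT.
  by apply: contra bZ => ->; rewrite bA orbT.
Qed.

Lemma sum_product_subset (R : rcfType) (p : nat) (A : {set 'F_p}) : prime p ->
  (2 ^ 8 ^ 2 ^ #|A| < p)%N ->
  exists m, [/\ (m <= #|A|)%N, (#|A| <= 24 * m + 8)%N &
    (m ^ 4)%:R <= 16%:R * (#|prodset A| * #|sumset A| ^ 2)%:R
                  * \sum_(t < m) (t.+1%:R : R)^-1].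
Proof.
move=> p_pr Ap.
have [C CA cC] : exists2 C : {set 'F_p}, C \subset A & #|C| = (#|A| %/ 3)%N.
  exists [set a in take (#|A| %/ 3) (enum A)].
    by apply/subsetP => a; rewrite inE => /mem_take; rewrite mem_enum.
  rewrite cardsE; have /card_uniqP -> := take_uniq (#|A| %/ 3) (enum_uniq A).
  by rewrite size_takel // -cardE leq_div.
have [phi iso] : exists phi : 'F_p -> R[i], sum_product_iso C phi.
  apply: rectification => //; apply: leq_ltn_trans Ap; rewrite cC.
  rewrite leq_pexp2l // leq_pexp2l //.
  (* A third of [A] turns the growth rate 5 into 2, because [5 <= 2 ^ 3]. *)
  apply: (@leq_trans (2 ^ (3 * (#|A| %/ 3)))).
    by rewrite expnM; case: (_ %/ _)%N => // q; rewrite leq_exp2r.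
  by rewrite leq_pexp2l // mulnC leq_divM.
have [B [BC cB B0 dotB]] := sum_product_dense_sector iso.
exists #|B|; split.
- exact: leq_trans (subset_leq_card BC) (subset_leq_card CA).
(* [24 * m + 8] is [3 * (8 * m + 2) + 2], the last 2 being the remainder modulo 3. *)
- by move: cB; rewrite cC; move: #|A| #|B| => x y; clear; lia.
apply: le_trans (sum_product_rectified (sum_product_iso_sub BC iso) B0 dotB) _.
have BA := subset_trans BC CA.
rewrite ler_wpM2r ?sumr_ge0 // => [t _|]; first by rewrite invr_ge0 ler0n.
rewrite ler_wpM2l ?ler0n // ler_nat leq_mul ?leq_exp2r //;
  by apply: subset_leq_card; apply: imset2S.
Qed.

(** * Asymptotics *)

From mathcomp Require Import all_classical.
From mathcomp Require Import reals topology normedtype sequences exp.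

Import numFieldNormedType.Exports.
Local Open Scope classical_set_scope.
Local Open Scope ring_scope.

(** A logarithm above [k >= 0] cannot be the default value 0, so [x] is positive. *)
Lemma log_gt_exp (R : realType) (b x : R) (k : nat) :
  1 < b -> k%:R < log b x -> b ^+ k < x.
Proof.
move=> b1; rewrite /log ltr_pdivlMr ?ln_gt0 // => kx.
have b0 : 0 < b by apply: lt_trans b1.
have x0 : 0 < x.
  rewrite ltNge; apply/negP => /ln0 e; move: kx; rewrite e ltNge.
  by rewrite mulr_ge0 // ltW // ln_gt0.
by rewrite -ltr_ln ?posrE ?exprn_gt0 // lnXn // -mulr_natl.
Qed.

Lemma iterated_log_gt (R : realType) (p n : nat) :
  (n%:R : R) < log 2 (log 8 (log 32 (p%:R : R))) - 1 -> (2 ^ 8 ^ 2 ^ n < p)%N.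
Proof.
rewrite ltrBrDr natr1 => /log_gt_exp; rewrite ltr1n -natrX => /(_ isT).
move=> /log_gt_exp; rewrite ltr1n -natrX => /(_ isT).
move=> /log_gt_exp; rewrite ltr1n -natrX ltr_nat => /(_ isT).
apply: leq_ltn_trans; apply: (@leq_trans (2 ^ (8 ^ 2 ^ n.+1))).
  by rewrite !leq_pexp2l.
by rewrite leq_exp2r // expn_gt0.
Qed.

(** Each step is [ln (1 + x) <= x] at [x = - 1 / (m + 2)]. *)
Lemma harmonic_le (R : realType) (m : nat) : (0 < m)%N ->
  \sum_(t < m) (t.+1%:R : R)^-1 <= 1 + ln m%:R.
Proof.
case: m => // m _; elim: m => [|m IH]; first by rewrite big_ord1 invr1 ln1 addr0.
rewrite big_ord_recr /=.
suff h : m.+2%:R^-1 <= ln m.+2%:R - ln m.+1%:R :> R.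
  by apply: le_trans (lerD IH h) _; rewrite addrA addrAC addrK.
have -> : ln m.+2%:R - ln m.+1%:R = - ln (1 + - m.+2%:R^-1) :> R.
  have -> : 1 + - m.+2%:R^-1 = m.+1%:R / m.+2%:R :> R.
    by rewrite -[m.+1%:R](addrK 1) natr1 mulrBl divff ?pnatr_eq0 // mul1r.
  by rewrite ln_div ?posrE ?ltr0n // opprB.
rewrite lerNr; apply: le_ln1Dx; rewrite ltrN2 invf_lt1 ?ltr0n //.
by rewrite ltr1n.
Qed.

Lemma inv_sqrt_ln_cvg0 (R : realType) :
  (Num.sqrt (ln n%:R : R))^-1 @[n --> \oo] --> (0 : R).
Proof.
apply/cvgrPdist_lt => e e0.
near=> n.
have : e^-1 < Num.sqrt (ln n%:R : R).
  rewrite -[e^-1]ger0_norm ?invr_ge0 ?ltW // -sqrtr_sqr.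
  have lt : expR (e^-1 ^+ 2) < n%:R by near: n; exact: nbhs_infty_gtr.
  have n0 : 0 < n%:R :> R := lt_trans (expR_gt0 _) lt.
  have h : e^-1 ^+ 2 < ln n%:R by rewrite -ltr_expR lnK.
  by rewrite ltr_sqrt // (le_lt_trans (sqr_ge0 _) h).
move=> h; have s0 : 0 < Num.sqrt (ln n%:R : R).
  by apply: lt_trans h; rewrite invr_gt0.
rewrite sub0r normrN ger0_norm ?invr_ge0 ?ltW //.
by rewrite -[e]invrK ltf_pV2 ?posrE ?invr_gt0.
Unshelve. all: by end_near. Qed.

(** With [v = sqrt (ln n)], the factor [n ^ (1 / v) = exp v] absorbs the logarithm:
    [1 + v ^ 2 <= (1 + v) ^ 3 <= exp (3 * v)]. *)
Lemma sum_product_bound_real (R : realType) (n m T : nat) :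
  (32 <= n)%N -> (m <= n)%N -> (n <= 24 * m + 8)%N ->
  (m ^ 4)%:R <= 16%:R * (T ^ 3)%:R * \sum_(t < m) (t.+1%:R : R)^-1 ->
  256^-1 * n%:R `^ (1 + 1 / 3 - (Num.sqrt (ln n%:R))^-1) <= (T%:R : R).
Proof.
move=> n32 mn nm hm.
have n0 : 0 < n%:R :> R by rewrite ltr0n; lia.
have m0 : 0 < m%:R :> R by rewrite ltr0n; lia.
have ln0 : 0 < ln (n%:R : R) by rewrite ln_gt0 // ltr1n; lia.
set v := Num.sqrt (ln (n%:R : R)).
have v0 : 0 < v by rewrite sqrtr_gt0.
have v2 : v ^+ 2 = ln n%:R by rewrite sqr_sqrtr // ltW.
have -> : n%:R `^ (1 + 1 / 3 - v^-1) = expR (4 / 3 * v ^+ 2 - v) :> R.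
  rewrite /powR gt_eqF // -v2; congr expR.
  by field; rewrite gt_eqF.
set X := expR _.
have X0 : 0 < X by exact: expR_gt0.
have X3 : X ^+ 3 * expR v ^+ 3 = (n ^ 4)%:R.
  rewrite natrX -{1}(lnK (n0 : n%:R \is Num.pos)) -v2 -!expRM_natl -expRD.
  by congr expR; field.
have ev : 1 + ln (n%:R : R) <= expR v ^+ 3.
  apply: (@le_trans _ _ ((1 + v) ^+ 3)); first by rewrite -v2; nra.
  by rewrite lerXn2r ?nnegrE ?expR_ge0 ?expR_ge1Dx //; lra.
(* Since [m >= 1], [n <= 32 * m]; with the factor 16 of [hm] this gives [2 ^ 24 = 256 ^ 3]. *)
have nm4 : (n ^ 4)%:R <= 2 ^+ 20 * (m ^ 4)%:R :> R.
  have -> : 2 ^+ 20 * (m ^ 4)%:R = ((32 * m) ^ 4)%:R :> R.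
    rewrite expnMn natrM; congr (_ * _).
    by rewrite -[32%N]/(2 ^ 5)%N -expnM natrX.
  by rewrite ler_nat leq_exp2r //; lia.
have Hm : \sum_(t < m) (t.+1%:R : R)^-1 <= 1 + ln n%:R.
  apply: le_trans (harmonic_le _ _) _; first by rewrite -(ltr0n R).
  by rewrite lerD2l ler_ln ?posrE // ler_nat.
have main : X ^+ 3 <= 2 ^+ 24 * (T ^ 3)%:R.
  rewrite -(ler_pM2r (exprn_gt0 3 (expR_gt0 v))) X3.
  apply: le_trans nm4 _; apply: le_trans (ler_wpM2l _ hm) _; first exact: exprn_ge0.
  have -> : 2 ^+ 20 * (16%:R * (T ^ 3)%:R * \sum_(t < m) t.+1%:R^-1) =
      2 ^+ 24 * (T ^ 3)%:R * \sum_(t < m) t.+1%:R^-1 :> R by ring.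
  by rewrite ler_wpM2l ?mulr_ge0 ?exprn_ge0 // (le_trans Hm).
rewrite -(@ler_pXn2r _ 3) ?nnegrE // ?mulr_ge0 ?invr_ge0 ?(ltW X0) //.
rewrite exprMn exprVn mulrC ler_pdivrMr ?exprn_gt0 // (le_trans main) //.
have -> : 2 ^+ 24 = 256 ^+ 3 :> R by ring.
by rewrite natrX mulrC.
Qed.

Theorem theorem3p2 (R : realType) :
  exists (c : R) (eps : nat -> R),
    [/\ 0 < c,
        eps n @[n --> \oo] --> (0 : R)
      & forall (p : nat) (A : {set 'F_p}),
          prime p ->
          (#|A|%:R : R) < log 2 (log 8 (log 32 (p%:R : R))) - 1 ->
          c * (#|A|%:R `^ (1 + 1 / 3 - eps #|A|))
            <= (#|sumset A| + #|prodset A|)%:R].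
Proof.
exists 256^-1, (fun n => (Num.sqrt (ln n%:R))^-1); split; first by rewrite invr_gt0.
  exact: inv_sqrt_ln_cvg0.
move=> p A p_pr /iterated_log_gt Ap.
have [n32|n32] := leqP 32 #|A|.
  have [m [mn nm hm]] := sum_product_subset R p_pr Ap.
  apply: (sum_product_bound_real n32 mn nm); apply: le_trans hm _.
  rewrite ler_wpM2r ?sumr_ge0 // => [t _|]; first by rewrite invr_ge0 ler0n.
  rewrite ler_wpM2l ?ler0n // ler_nat [leqRHS]expnS.
  apply: leq_mul; first exact: leq_addl.
  by rewrite leq_exp2r // leq_addr.
(* For the empty set [ln 0 = 0] and its inverse root is 0, so the power is [0 ^ (4 / 3) = 0]. *)
have [-> |A0] := posnP #|A|.
  rewrite ln0 // sqrtr0 invr0 subr0 powR0 ?mulr0 ?ler0n // gt_eqF //; lra.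
(* Below 32 elements the trivial bound [#|A| <= #|A + A|] suffices, the exponent being at most 2. *)
apply: (@le_trans _ _ (256^-1 * (#|A|%:R `^ 2))).
  rewrite ler_wpM2l ?invr_ge0 // ler_powR ?ler1n //.
  have : 0 <= (Num.sqrt (ln (#|A|%:R : R)))^-1 by rewrite invr_ge0 sqrtr_ge0.
  lra.
rewrite powR_mulrn ?ler0n //; apply: (@le_trans _ _ (#|A|%:R)).
  have : #|A|%:R <= 32%:R :> R by rewrite ler_nat ltnW.
  have : 0 <= #|A|%:R :> R by rewrite ler0n.
  nra.
by rewrite ler_nat (leq_trans (leq_card_sumset A)) // leq_addr.
Qed.
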